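(* Let $X$ be a finite discrete topological space with at least two elements, let $\Gamma$ be a nonempty set, and let $\varphi:\Gamma\to\Gamma$ be an arbitrary map. Let $\sigma_\varphi:X^\Gamma\to X^\Gamma$, $\sigma_\varphi((x_\theta)_{\theta\in\Gamma})=(x_{\varphi(\theta)})_{\theta\in\Gamma}$, be the associated generalized shift, where $X^\Gamma$ carries the product topology and its unique compatible uniform structure $\mathcal U$. The following statements are equivalent: (1) $(X^\Gamma,\sigma_\varphi)$ has uniform stroboscopical property; (2) $(X^\Gamma,\sigma_\varphi)$ has stroboscopical property; (3) $\varphi:\Gamma\to\Gamma$ is one-to-one.
   Context: Uniform structure on $X^\Gamma$: for $H\subseteq\Gamma$ let $\alpha_H:=\{((x_\theta)_{\theta\in\Gamma},(y_\theta)_{\theta\in\Gamma})\in X^\Gamma\times X^\Gamma:\forall\theta\in H\ (x_\theta=y_\theta)\}$. The unique compatible uniform structure on the compact Hausdorff space $X^\Gamma$ is $\mathcal U:=\{D\subseteq X^\Gamma\times X^\Gamma:$ there exists a finite subset $H$ of $\Gamma$ with $\alpha_H\subseteq D\}$. Stroboscopical properties: let $Z$ be a topological space, $f:Z\to Z$ continuous, and $\mathbb N=\{1,2,\ldots\}$. For $x\in Z$ and a strictly increasing sequence $A=\{n_i\}_{i\ge0}$ in $\mathbb N$ let $\omega_f(A,x)=\{y\in Z:\{f^{n_i}(x)\}_{i\ge0}$ has a subsequence converging to $y\}$. The dynamical system $(Z,f)$ has stroboscopical property if for every $z\in Z$ and every strictly increasing sequence $A$ in $\mathbb N$ the set $\{x\in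 Z:z\in\omega_f(A,x)\}$ is nonempty. If $(Z,\mathcal F)$ is a uniform space, $(Z,f)$ has uniform stroboscopical property if for every strictly increasing sequence $A=\{n_i\}_{i\ge0}$ in $\mathbb N$ there exist a subsequence $B=\{k_i\}_{i\ge0}$ of $A$ and a map $\varrho:Z\to Z$ (not assumed continuous) such that the sequence $\{f^{k_i}\circ\varrho\}_{i\ge0}$ converges uniformly (with respect to $\mathcal F$) to the identity map $id_Z$. *)

(* Defs.v *)
From HB Require Import structures.
From mathcomp Require Import all_boot finmap all_classical topology.

Set Implicit Arguments.
Unset Strict Implicit.
Unset Printing Implicit Defensive.

Local Open Scope classical_set_scope.

(* Sequences are indexed from 0, but their values are taken in {1, 2, ...}. *)
Definition time_sequence (A : nat -> nat) : Prop :=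
  {homo A : i j / (i < j)%N} /\ (forall i : nat, (0 < A i)%N).

Definition subsequence (T : Type) (v u : nat -> T) : Prop :=
  exists2 s : nat -> nat, {homo s : i j / (i < j)%N} & v = u \o s.

Definition omega_limit_along (Z : topologicalType) (f : Z -> Z)
    (A : nat -> nat) (x : Z) : set Z :=
  [set y : Z | exists2 v : nat -> Z,
     subsequence v (fun i : nat => iter (A i) f x) & v @ \oo --> y].

Definition stroboscopical (Z : topologicalType) (f : continuousType Z Z) :
    Prop :=
  forall (z : Z) (A : nat -> nat), time_sequence A ->
    [set x : Z | omega_limit_along f A x z] !=set0.

Definition uniformly_stroboscopical (Z : uniformType)
    (f : continuousType Z Z) : Prop :=
  forall A : nat -> nat, time_sequence A ->
    exists (B : nat -> nat) (rho : Z -> Z), subsequence B A /\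
      {uniform, (fun i : nat => iter (B i) f \o rho) @ \oo --> (id : Z -> Z)}.

Notation config X Gamma := {ptws Gamma -> discrete_topology X}.

Definition agree_on (X : finType) (Gamma : Type) (H : set Gamma) :
    set (config X Gamma * config X Gamma) :=
  [set xy | forall theta : Gamma, H theta -> xy.1 theta = xy.2 theta].

Lemma config_nbhs_agree (X : finType) (Gamma : Type) (x : config X Gamma)
    (theta : Gamma) :
  nbhs x [set y : config X Gamma | x theta = y theta].
Proof.
have /cvg_sup/(_ theta) h : nbhs x --> x by exact: cvg_id.
apply: h; exists [set y : config X Gamma | x theta = y theta] => //.
split=> //; exists [set c : discrete_topology X | x theta = c] => //.
exact: discrete_open.
Qed.

(* The product uniformity, generated by the relations of agreement on a finite
   set of coordinates, is the unique one compatible with the compact Hausdorff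
   product topology. *)
Lemma config_entourageE (X : finType) (Gamma : Type) :
  @entourage (config X Gamma) =
  [set D | exists2 H : set Gamma, finite_set H & agree_on H `<=` D].
Proof.
apply/seteqP; split=> D.
  move=> [B [F _ <-] BD].
  exists ((fun w => (projT1 w).1) @` [set` F]).
    exact/finite_image/finite_fset.
  move=> [x y] xyF; apply: BD => w wF /=.
  have [V /= entV sV] : @entourage (initial_topology
      (@proj Gamma (fun=> discrete_topology X) (projT1 w).1)) (projT1 w).2.
    exact/asboolP/(projT2 w).
  apply: sV; apply: entV; exists (x (projT1 w).1) => //.
  have xyw : x (projT1 w).1 = y (projT1 w).1.
    by apply: xyF; exists w.
  by rewrite -[unstable.map_pair _ _]/(x (projT1 w).1, y (projT1 w).1) xyw.
move=> [H finH] HD; apply: (filterS HD).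
have -> : agree_on H = \bigcap_(theta in H) agree_on (X := X) [set theta].
  apply/seteqP; split=> -[x y] xyH; first by move=> theta Htheta _ ->; exact: xyH.
  by move=> theta Htheta; exact: (xyH theta).
have entF : Filter (@entourage (config X Gamma)) by exact: entourage_filter.
suff ent1 (theta : Gamma) :
    @entourage (config X Gamma) (agree_on (X := X) [set theta]).
  have [K ->] := (@finite_fsetP {classic Gamma} H).1 finH.
  pose f (theta : {classic Gamma}) := agree_on (X := X) [set theta : Gamma].
  exact: (@filter_bigI _ _ K f _ entF (fun theta _ => ent1 theta)).
have pf : `[< @entourage (initial_topology
    (@proj Gamma (fun=> discrete_topology X) theta))
    (agree_on [set theta]) >].
  apply/asboolP; exists [set c | c.1 = c.2]; first by move=> _ [c _ <-].
  by move=> [x y] /= xy _ ->.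
exists (agree_on [set theta]) => //.
exists [fset exist (fun p : {classic Gamma} * _ =>
    `[< @entourage (initial_topology
      (@proj Gamma (fun=> discrete_topology X) p.1)) p.2 >])
    (theta, agree_on [set theta]) pf]%fset; first by move=> ? _; exact: in_setT.
by rewrite set_fset1 bigcap_set1.
Qed.

Definition generalized_shift (X : finType) (Gamma : Type)
    (phi : Gamma -> Gamma) (x : config X Gamma) : config X Gamma :=
  fun theta : Gamma => x (phi theta).

Lemma generalized_shift_continuous (X : finType) (Gamma : Type)
    (phi : Gamma -> Gamma) :
  continuous (@generalized_shift X Gamma phi).
Proof.
move=> x.
have FF : Filter (nbhs (generalized_shift phi @ x)).
  by apply: fmap_filter; exact: nbhs_filter.
apply/cvg_sup => theta W [_ [[V _ <-] Vx sV]].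
apply: filterS (config_nbhs_agree x (phi theta)) => y /= xy.
by apply: sV; move: Vx; rewrite /= /generalized_shift xy.
Qed.

HB.instance Definition _ (X : finType) (Gamma : Type) (phi : Gamma -> Gamma) :=
  @isContinuous.Build (config X Gamma) (config X Gamma)
    (@generalized_shift X Gamma phi) (@generalized_shift_continuous X Gamma phi).

(* Main.v *)
Require Import Defs.
From mathcomp Require Import all_boot all_classical topology.
From mathcomp Require Import zify.
From mathcomp Require Import zify.

(** Everything happens on the index set: [iter n (generalized_shift phi) x] is
    [x] read along [iter n phi].

    If [phi] identifies two indices, every forward image of a configuration
    takes equal values at them, and so does every limit of such images; a
    configuration with different values there is the limit of none of them
    ([stroboscopical_inj]).

    Suppose that [phi] is injective. The point is to find, for a suitable
    subsequence [B] of the given times, one map [back] on indices such that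
    [back (iter (B i) phi theta) = theta] for every [theta] and all [i] large
    enough, depending on [theta]. The shift along [back] is then the required
    map [rho]: on a finite set of coordinates the composites are eventually
    equal to the identity, for all configurations at once, and agreement on
    finite sets of coordinates is what the product uniformity measures.

    Such a map exists as soon as different indices are never sent to the same
    place, at times that are admissible for each of them ([eventual_return]).
    A coincidence of images at the times [B i] and [B j], [i < j], puts the two
    indices on one [phi]-orbit at distance [B j - B i]. On an infinite orbit,
    coordinates relative to a base point are unbounded but fixed, so that gaps of
    [B] beyond [i + j] exclude this once [i] and [j] exceed the two coordinates.
    On a finite orbit the coincidence is harmless if the period divides
    [B j - B i], since then the two indices are equal; it is enough that [i] is
    at least the period and that [i`!] divides [B j - B i].
    [orbit_height] treats both kinds of orbits at once, and [sparse_congruent]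
    extracts [B], an ultrafilter being used to choose the residues of the times
    modulo all the factorials coherently. No countability of the set of indices
    is involved, because the conditions on [B] do not refer to it. *)

Local Open Scope classical_set_scope.

(** * Subsequences of times *)

Lemma increasing_gap (A : nat -> nat) :
  {homo A : i j / (i < j)%N} -> forall i j, (i <= j)%N -> (A i + (j - i) <= A j)%N.
Proof.
move=> Amono i j; elim: j => [|j IH] ij; first by have -> : i = 0%N; lia.
have := Amono j j.+1 (ltnSn j).
by have [->|] := eqVneq i j.+1; [lia | move=> *; have := IH ltac:(lia); lia].
Qed.

(** The finitely many residue classes modulo [m] cover everything, so one of
    them must be large. *)
Lemma ultra_residue (T : Type) (F : set_system T) (u : T -> nat) (m : nat) :
  UltraFilter F -> (0 < m)%N -> exists r, \forall x \near F, u x %% m = r.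
Proof.
move=> UF m0; apply: contrapT => none.
have others (r : 'I_m) : \forall x \near F, u x %% m <> r.
  have [large|//] := in_ultra_setVsetC [set x | u x %% m = r] UF.
  by case: none; exists (r : nat).
have [x ux] := filter_ex (filter_forall _ others).
exact: (ux (Ordinal (ltn_pmod (u x) m0))).
Qed.

(** The residues of the chosen times modulo each [k`!] are those singled out by
    one ultrafilter at infinity: any finite number of these congruences then has
    arbitrarily late common solutions. *)
Lemma sparse_congruent (A : nat -> nat) : {homo A : i j / (i < j)%N} ->
  exists B : nat -> nat, [/\ subsequence B A,
    forall i j, (i < j)%N -> (i + j < B j - B i)%N &
    forall i j, (i < j)%N -> i`! %| B j - B i].
Proof.
move=> Amono.
have [U [UU leU]] := ultraFilterLemma eventually_filter.
have [r Ar] := choice (fun k => ultra_residue _ U A k`! UU (fact_gt0 k)).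
have late k N : exists n, (N < n)%N /\
    forall j, (j <= k)%N -> A n %% j`! = r j.
  suff : \forall n \near U, (N < n)%N /\
      forall j : 'I_k.+1, A n %% j`! = r j.
    move=> /filter_ex [n [Nn An]]; exists n; split=> // j jk.
    exact: (An (Ordinal (jk : (j < k.+1)%N))).
  apply: filterI; first by apply: leU; exists N.+1.
  by apply: filter_forall => j; exact: Ar.
have {late} [next nextP] := choice (fun kN : nat * nat => late kN.1 kN.2).
(* The slack [k.*2] makes the k-th gap exceed 2k, hence i + j when i < j = k. *)
pose s := fix s k := if k is k'.+1 then next (k, s k' + k.*2) else next (0, 0).
have sS k : (s k + k.+1.*2 < s k.+1)%N by case: (nextP (k.+1, s k + k.+1.*2)).
have sr k j : (j <= k)%N -> A (s k) %% j`! = r j.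
  by case: k => [|k] jk; [case: (nextP (0, 0)) | case: (nextP (k.+1, s k + k.+1.*2))]
    => _; apply.
have smono : {homo s : i j / (i < j)%N}.
  apply: homo_ltn => [y x z|i]; first exact: ltn_trans.
  by have := sS i; lia.
have gap i j : (i < j)%N -> (A (s i) + i + j < A (s j))%N.
  case: j => // j ij; have sij : (s i <= s j)%N.
    by move: ij; rewrite ltnS leq_eqVlt => /predU1P[->//|/smono/ltnW].
  have := sS j.
  have := increasing_gap A Amono (s i) (s j.+1) ltac:(have := sS j; lia).
  lia.
exists (A \o s); split=> [|i j ij|i j ij] /=.
- by exists s.
- by have := gap i j ij; lia.
- rewrite -eqn_mod_dvd; last by have := gap i j ij; lia.
  by rewrite !sr // ltnW.
Qed.

(** * Orbits of an injective map *)

Section InjectiveOrbits.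
Variables (T : Type) (phi : T -> T).
Hypothesis phi_inj : injective phi.

Lemma iter_dvdn_fix (p d : nat) (t : T) :
  p %| d -> iter p phi t = t -> iter d phi t = t.
Proof. by move=> /dvdnP[k ->] pt; rewrite iterM iter_fix. Qed.

Lemma iter_inj (n : nat) : injective (iter n phi).
Proof. by elim: n => // n IH x y /= /phi_inj/IH. Qed.

(** The height of [t] bounds its position relative to a base point of its orbit,
    chosen once for all points of the orbit, and also the period of [t] when it
    has one. Two points further apart than the sum of their heights can only lie
    on a finite orbit; the period is then at most the height of either point, so
    it divides [n`!] for every larger [n]. *)
Lemma orbit_height : inhabited T -> exists h : T -> nat, forall d n t,
  (h t + h (iter d phi t) < d)%N -> (h (iter d phi t) <= n)%N ->
  iter n`! phi t = t.
Proof.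
move=> [t0].
pose orb t : set {classic T} := [set u | exists a b, iter a phi t = iter b phi u].
pose base t : T := xget (t0 : {classic T}) (orb t).
have base_orb t : orb t (base t).
  by apply: (@xgetI {classic T} t0 (orb t) t); exists 0%N, 0%N.
have base_iter d t : base (iter d phi t) = base t.
  suff orbE : orb (iter d phi t) = orb t by rewrite /base orbE.
  apply/seteqP; split=> u [a [b ab]]; first by exists (a + d)%N, b; rewrite iterD.
  by exists a, (d + b)%N; rewrite -iterD addnC !iterD ab.
have bounded t : exists n : nat,
    (exists a b, [/\ (a <= n)%N, (b <= n)%N &
       iter a phi t = iter b phi (base t)]) /\
    ((exists p, (0 < p)%N /\ iter p phi t = t) ->
       exists p, (0 < p <= n)%N /\ iter p phi t = t).
  have [a [b ab]] := base_orb t.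
  have [[p [p0 pt]]|aper] :=
      pselect (exists p, (0 < p)%N /\ iter p phi t = t).
    exists (a + b + p)%N; split=> [|_]; first by exists a, b; split=> //; lia.
    by exists p; split=> //; lia.
  by exists (a + b)%N; split=> [|/aper//]; exists a, b; split=> //; lia.
have [h hP] := choice bounded.
exists h => d n t far; set u := iter d phi t in far * => un.
have [[a [b [ah bh ab]]] _] := hP t.
have [[a' [b' [ah' bh' ab']]] per_u] := hP u.
(* Both paths from [t] end at the image of the common base point under
   [iter (b + b') phi], and the first is longer. *)
have twice : iter (a' + b + d) phi t = iter (b' + a) phi t.
  rewrite (addnC a') -addnA iterD (iterD a' d) -/u ab' -iterD.
  by rewrite (iterD b' a) ab -iterD base_iter addnC.
have [p [/andP[p0 ph] pu]] : exists p, (0 < p <= h u)%N /\ iter p phi u = u.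
  apply: per_u; exists (a' + b + d - (b' + a))%N; split; first lia.
  rewrite /u -iterD addnC iterD; congr (iter d phi _).
  by apply: (@iter_inj (b' + a)); rewrite -iterD subnKC //; lia.
apply: (@iter_dvdn_fix p); first by rewrite dvdn_fact // p0 (leq_trans ph).
by apply: (@iter_inj d); rewrite -iterD addnC iterD.
Qed.

(** The admissible times for [t] are the [B i] with [i] at least the height of
    [t]. A point [v] is reached from at most one [t] at an admissible time, which
    is the value required of [back] at [v]. *)
Lemma eventual_return (B : nat -> nat) : inhabited T ->
    (forall i j, (i < j)%N -> (i + j < B j - B i)%N) ->
    (forall i j, (i < j)%N -> i`! %| B j - B i) ->
  exists back : T -> T, forall t, \forall i \near \oo, back (iter (B i) phi t) = t.
Proof.
move=> inhT sparse congruent.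
have [h hP] := orbit_height inhT.
have collide i j t u : (i < j)%N -> (h t <= i)%N -> (h u <= j)%N ->
    iter (B i) phi t = iter (B j) phi u -> t = u.
  move=> ij ti uj; have gap := sparse i j ij.
  rewrite -(@subnKC (B i) (B j)); last lia.
  rewrite iterD => /iter_inj tE; rewrite tE in ti *.
  by apply: iter_dvdn_fix (congruent i j ij) _; apply: hP (ti); lia.
have origin v : exists w, forall i t,
    (h t <= i)%N -> v = iter (B i) phi t -> w = t.
  have [[i [t [ti ->]]]|none] :=
      pselect (exists i t, (h t <= i)%N /\ v = iter (B i) phi t).
    exists t => j u uj E; case: (ltngtP i j) => ij.
    - exact: collide ij ti uj E.
    - exact/esym/(collide _ _ _ _ ij uj ti)/esym.
    - by rewrite ij in E; exact: iter_inj E.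
  by exists v => i t ti E; case: none; exists i, t.
have [back backP] := choice origin.
by exists back => t; exists (h t) => // i /= ti; exact: backP ti _.
Qed.

End InjectiveOrbits.

(** * The stroboscopical properties *)

Lemma iter_generalized_shift (X : finType) (Gamma : Type)
    (phi : Gamma -> Gamma) (n : nat) (x : config X Gamma) :
  iter n (generalized_shift phi) x = x \o iter n phi.
Proof.
elim: n => // n IH; rewrite iterS IH; apply/funext => theta.
by rewrite /generalized_shift /= -iterSr.
Qed.

Lemma uniformly_stroboscopicalW (Z : uniformType) (f : continuousType Z Z) :
  uniformly_stroboscopical f -> stroboscopical f.
Proof.
move=> uf z A /uf[B [rho [[s smono ->] cvg_rho]]].
exists (rho z); exists (fun i => iter (A (s i)) f (rho z)); first by exists s.
have := uniform_subset_cvg _ (@subsetT _ [set z]) cvg_rho.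
by rewrite uniform_set1; apply.
Qed.

Lemma stroboscopical_inj (X : finType) (Gamma : Type) (phi : Gamma -> Gamma) :
  (1 < #|X|)%N -> stroboscopical (@generalized_shift X Gamma phi) ->
  injective phi.
Proof.
move=> /card_gt1P[c [d [_ _ cd]]] strobo a b phi_ab; apply: contrapT => ab.
pose z : config X Gamma := fun theta => if pselect (theta = a) then c else d.
(* The times [S i] are positive, so the images of [a] and [b] already agree. *)
have [|x [_ [s _ ->] cvg_z]] := strobo z S; first by split=> // i j; rewrite ltnS.
have : \forall i \near \oo, c = d.
  near=> i.
  have za : z a = iter (s i).+1 (generalized_shift phi) x a.
    by near: i; exact: (cvg_z _ (config_nbhs_agree z a)).
  have zb : z b = iter (s i).+1 (generalized_shift phi) x b.
    by near: i; exact: (cvg_z _ (config_nbhs_agree z b)).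
  have shift_ab : (x \o iter (s i).+1 phi) a = (x \o iter (s i).+1 phi) b.
    by rewrite /comp !iterSr phi_ab.
  move: za; rewrite iter_generalized_shift shift_ab -iter_generalized_shift -zb.
  by rewrite /z; case: pselect => // ? /=; case: pselect => //= /esym.
by move=> /filter_ex[_ cdE]; rewrite cdE eqxx in cd.
Unshelve. all: by end_near. Qed.

Lemma inj_uniformly_stroboscopical (X : finType) (Gamma : Type)
    (phi : Gamma -> Gamma) : inhabited Gamma ->
  injective phi -> uniformly_stroboscopical (@generalized_shift X Gamma phi).
Proof.
move=> inhG phi_inj A [/sparse_congruent[B [BA sparse congruent]] _].
have [back backP] := eventual_return _ _ phi_inj _ inhG sparse congruent.
exists B, (generalized_shift back); split=> //.
move=> P /uniform_nbhs[E []]; rewrite config_entourageE => -[H finH HE] EP.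
have : \forall i \near \oo, forall theta, H theta ->
    back (iter (B i) phi theta) = theta.
  have [K ->] := (@finite_fsetP {classic Gamma} H).1 finH.
  pose f theta : set nat := [set i | back (iter (B i) phi theta) = theta].
  exact: (@filter_bigI _ {classic Gamma} K f _ _ (fun theta _ => backP theta)).
apply: filterS => i backH; apply: EP => x _; apply: HE => theta /backH backE.
by rewrite /= iter_generalized_shift /= /generalized_shift backE.
Qed.

Theorem mainTheorem3 (X : finType) (Gamma : Type) (phi : Gamma -> Gamma)
    (hX : (1 < #|X|)%N) (hGamma : inhabited Gamma) :
  [<-> uniformly_stroboscopical (@generalized_shift X Gamma phi);
       stroboscopical (@generalized_shift X Gamma phi);
       injective phi].
Proof.
tfae.
- exact: uniformly_stroboscopicalW.
- exact: stroboscopical_inj.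
- exact: inj_uniformly_stroboscopical.
Qed.
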